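(* For $n\ge 0$ let $a(n)$ be the number of compositions of $n$ that avoid each of the three compositions $252$, $343$, $424$ (i.e. $2\,5\,2$, $3\,4\,3$, $4\,2\,4$). Then $$\sum_{n=0}^{\infty} a(n)\,x^n = -\frac{x^{17}+3x^{14}+x^{13}-3x^{11}+x^{10}+x^{6}-x^{5}+x^{4}+x^{2}-2x+1}{x^{18}+3x^{15}+2x^{14}-2x^{13}-2x^{12}+3x^{11}-3x^{10}+x^{8}+x^{7}-x^{6}+2x^{5}-x^{4}-2x^{2}+3x-1}.$$ The first 31 terms $a(0),\dots,a(30)$ are $1, 1, 2, 4, 8, 16, 32, 64, 128, 255, 505, 998, 1971, 3893, 7697, 15223, 30113, 59575, 117861, 233164, 461250, 912423, 1804882, 3570257, 7062369, 13970211, 27634848, 54665348, 108135332, 213906125, 423134791$. Moreover $\lim_{n\to\infty} a(n+1)/a(n) = r$ with $r=1.9781317474\ldots$, and $a(n)\sim c\,r^n$ with $c=0.54805291269\ldots$.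
   Context: A composition of a non-negative integer $n$ is a finite ordered list $a_1 a_2\cdots a_k$ of positive integers with $a_1+\cdots+a_k=n$ (the empty composition is the unique composition of $0$). A composition $a_1\cdots a_k$ includes (contains) the composition $b_1\cdots b_s$ if $k\ge s$ and there exists $i$ with $1\le i\le k-s+1$ such that $b_j\le a_{i+j-1}$ for all $j=1,\dots,s$. It avoids $b_1\cdots b_s$ if it does not include it. The decimal constants are given by their printed initial digits. *)

(* Defs.v *)
From Stdlib Require Import Reals ZArith.

(* The first 31 terms a(0..30) as stated in the paper, as binary integers (Z),
   defined before MathComp is loaded so that the literals are Stdlib Z. *)
Definition a_first_terms : list Z :=
  ((1 :: 1 :: 2 :: 4 :: 8 :: 16 :: 32 :: 64 :: 128 :: 255 :: 505 :: 998 :: 1971 ::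
   3893 :: 7697 :: 15223 :: 30113 :: 59575 :: 117861 :: 233164 :: 461250 ::
   912423 :: 1804882 :: 3570257 :: 7062369 :: 13970211 :: 27634848 ::
   54665348 :: 108135332 :: 213906125 :: 423134791 :: nil)%Z)%list.
From mathcomp Require Import all_boot all_order all_algebra.

Set Implicit Arguments.
Unset Strict Implicit.
Unset Printing Implicit Defensive.

Import GRing.Theory Num.Theory.

Definition is_composition (n : nat) (s : seq nat) : bool :=
  all (fun x => 0 < x)%N s && (sumn s == n).

Definition includes (a b : seq nat) : bool :=
  (size b <= size a)%N &&
  has (fun i => all (fun j => nth 0 b j <= nth 0 a (i + j))%N (iota 0 (size b)))
      (iota 0 (size a - size b).+1).

Definition avoids (a b : seq nat) : bool := ~~ includes a b.

Definition avoids_all (a : seq nat) : bool :=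
  [&& avoids a [:: 2; 5; 2], avoids a [:: 3; 4; 3] & avoids a [:: 4; 2; 4]]%N.

(* a(n): number of compositions of n avoiding 252, 343 and 424.
   Every composition of n has at most n parts, each at most n, so it is
   represented exactly once as a k-tuple over 'I_(n+1) for a unique k <= n. *)
Definition a (n : nat) : nat :=
  \sum_(k < n.+1)
     #|[set t : k.-tuple 'I_n.+1 |
         is_composition n (map val t) && avoids_all (map val t)]|.

(* Numerator P and denominator Q of the generating function -P/Q,
   as coefficient lists (constant term first). *)
Definition Pnum : seq int :=
  [:: 1; -2; 1; 0; 1; -1; 1; 0; 0; 0; 1; -3; 0; 1; 3; 0; 0; 1]%R.
Definition Qden : seq int :=
  [:: -1; 3; -2; 0; -1; 2; -1; 1; 1; 0; -3; 3; -2; -2; 2; 3; 0; 0; 1]%R.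

(* Main.v *)
(* A composition avoids the three patterns iff no three consecutive parts dominate one of them,
   which a 7-state automaton reading the parts can test. The generating functions of its states
   satisfy a linear system over [Z[x, 1/(1-x)]], whose solution for the initial state is [-P/Q].

   For the asymptotics, a suitable polynomial multiple of [Q] gives a recurrence of order 28 for
   [a] with nonnegative coefficients and a positive coefficient at [a (n - 1)]. If [r] is the
   positive root of its characteristic polynomial, then each [a n / r ^ n] is a convex combination
   of its 28 predecessors with a fixed positive weight on the last one; hence the interval spanned
   by 28 consecutive values shrinks geometrically, the sequence converges, and its limit [c] lies
   in the interval spanned by any such window. The window [56 <= n < 84] gives the digits of [c]. *)
Require Import Defs.
From Stdlib Require Import Reals ZArith Lra.
From mathcomp Require Import all_boot all_order all_algebra.
From mathcomp Require Import ssrZ zify.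

Set Implicit Arguments.
Unset Strict Implicit.
Unset Printing Implicit Defensive.

Import GRing.Theory Num.Theory.

(** * Sequences of weighted averages *)

Local Open Scope R_scope.

Lemma sum_f_R0_ge_last (f : nat -> R) (N : nat) :
  (forall j, (j <= N)%N -> 0 <= f j) -> f N <= sum_f_R0 f N.
Proof.
case: N => [|N] f_ge0; first exact: Rle_refl.
have : 0 <= sum_f_R0 f N.
  rewrite -[X in X <= _](Rmult_0_l (INR N.+1)) -sum_cte.
  by apply: sum_Rle => j le_jN; apply: f_ge0; lia.
by move=> /= ?; lra.
Qed.

Definition averaging (N : nat) (w x : nat -> R) : Prop :=
  [/\ forall j, (j <= N)%N -> 0 <= w j, 0 < w N, sum_f_R0 w N = 1
    & forall n, x (n + N.+1)%N = sum_f_R0 (fun j => w j * x (n + j)%N) N].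

Lemma averaging_opp (N : nat) (w x : nat -> R) :
  averaging N w x -> averaging N w (fun n => - x n).
Proof.
case=> w_ge0 w_gt0 w1 x_rec; split=> // n.
have -> (s : R) : - s = -1 * s by lra.
rewrite x_rec scal_sum; apply: PartSum.sum_eq => j _; lra.
Qed.

Section Averaging.
Context (N : nat) (w x : nat -> R) (avg : averaging N w x).

Lemma averaging_last_le1 : w N <= 1.
Proof. by case: avg => w_ge0 _ <- _; apply: sum_f_R0_ge_last. Qed.

(** As the weights sum to 1, the gap below [hi] of the new term is the weighted sum of the earlier
    gaps. These are nonnegative, so it is at least its last summand. *)
Lemma averaging_step (n : nat) (hi : R) :
  (forall i, (i <= N)%N -> x (n + i)%N <= hi) ->
  x (n + N.+1)%N <= hi - w N * (hi - x (n + N)%N).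
Proof.
case: avg => w_ge0 _ w1 x_rec le_hi; rewrite x_rec.
have := @sum_f_R0_ge_last (fun j => w j * hi - w j * x (n + j)%N) N.
rewrite minus_sum -scal_sum w1 => le_sum.
suff: w N * hi - w N * x (n + N)%N <= hi * 1 - sum_f_R0 (fun j => w j * x (n + j)%N) N by lra.
apply: le_sum => j le_jN; rewrite -Rmult_minus_distr_l.
by apply: Rmult_le_pos; [exact: w_ge0 | have := le_hi j le_jN; lra].
Qed.

Lemma averaging_bound (n : nat) (hi : R) :
  (forall i, (i <= N)%N -> x (n + i)%N <= hi) -> forall i, x (n + i)%N <= hi.
Proof.
move=> le_hi i; have [b] := ubnP i; elim: b => // b IHb in i *; rewrite ltnS => le_ib.
have [|lt_Ni] := leqP i N; first exact: le_hi.
have [k def_i] : exists k, i = (k + N.+1)%N by exists (i - N.+1)%N; lia.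
have le_k j : (j <= N)%N -> x (n + k + j)%N <= hi.
  by move=> le_jN; rewrite -addnA; apply: IHb; lia.
have := averaging_step le_k; rewrite def_i addnA => /Rle_trans; apply.
have := le_k N (leqnn N); case: avg => _ w_gt0 _ _ le_last.
by have := Rmult_le_pos (w N) (hi - x (n + k + N)%N); lra.
Qed.

Lemma averaging_decay (n i : nat) (hi : R) :
  (forall j, x (n + j)%N <= hi) ->
  x (n + N + i)%N <= hi - w N ^ i * (hi - x (n + N)%N).
Proof.
case: (avg) => _ w_gt0 _ _ le_hi; elim: i => [|i IHi]; first by rewrite addn0 /=; lra.
have le_hi' j : (j <= N)%N -> x (n + i + j)%N <= hi by rewrite -addnA.
have := averaging_step le_hi'.
rewrite (_ : n + i + N.+1 = n + N + i.+1)%N; last by lia.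
rewrite (_ : n + i + N = n + N + i)%N /=; last by lia.
move=> /Rle_trans; apply.
have := Rmult_le_compat_l (w N) _ _ (Rlt_le _ _ w_gt0) IHi; lra.
Qed.

(** The term [x (n + N)] lies at least half the width below [hi]. By [averaging_decay] the [N + 1]
    terms starting there all keep [w N ^ N] times that gap, and [averaging_bound] passes the bound
    on to all later terms. *)
Lemma averaging_contract_le (n : nat) (lo hi : R) :
  lo <= hi -> (forall j, lo <= x (n + j)%N <= hi) -> x (n + N)%N <= (lo + hi) / 2 ->
  forall j, lo <= x (n + N + j)%N <= hi - w N ^ N * ((hi - lo) / 2).
Proof.
move=> le_lohi bnd le_mid j; split; first by rewrite -addnA; apply: (bnd _).1.
apply: averaging_bound => i le_iN.
apply: Rle_trans (averaging_decay _ (fun j => (bnd j).2)) _.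
have [w_ge0 w_gt0 _ _] := avg; have w_le1 := averaging_last_le1.
have le_pow : w N ^ N <= w N ^ i.
  move: w_gt0 w_le1; set d := w N => d_gt0 d_le1.
  rewrite -(subnKC le_iN) pow_add -[X in _ <= X]Rmult_1_r.
  apply: Rmult_le_compat_l; first by apply: pow_le; lra.
  by rewrite -(pow1 (N - i)); apply: pow_incr; lra.
have := Rmult_le_compat (w N ^ N) (w N ^ i) ((hi - lo) / 2) (hi - x (n + N)%N).
by have := pow_lt _ N w_gt0; lra.
Qed.
End Averaging.

Lemma averaging_contract (N : nat) (w x : nat -> R) (n : nat) (lo hi : R) :
  averaging N w x -> lo <= hi -> (forall j, lo <= x (n + j)%N <= hi) ->
  exists lo' hi', [/\ lo' <= hi', hi' - lo' = (1 - w N ^ N / 2) * (hi - lo)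
    & forall j, lo' <= x (n + N + j)%N <= hi'].
Proof.
move=> avg le_lohi bnd.
have [le_mid | ge_mid] := Rle_lt_dec (x (n + N)%N) ((lo + hi) / 2).
  exists lo, (hi - w N ^ N * ((hi - lo) / 2)).
  have res := averaging_contract_le avg le_lohi bnd le_mid.
  by split=> //; [have := res 0%N; lra | lra].
(* In the upper half, the same argument for [- x] raises [lo] instead. *)
exists (lo + w N ^ N * ((hi - lo) / 2)), hi.
have bnd' j : - hi <= - x (n + j)%N <= - lo by have := bnd j; lra.
have le_mid' : - x (n + N)%N <= (- hi + - lo) / 2 by lra.
have res j : lo + w N ^ N * ((hi - lo) / 2) <= x (n + N + j)%N <= hi.
  have := averaging_contract_le (averaging_opp avg) (Ropp_le_contravar _ _ le_lohi) bnd' le_mid' j.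
  lra.
by split=> //; [have := res 0%N; lra | lra].
Qed.

Lemma averaging_cv (N : nat) (w x : nat -> R) (n : nat) (lo hi : R) :
  averaging N w x -> (forall i, (i <= N)%N -> lo <= x (n + i)%N <= hi) ->
  exists2 c, Un_cv x c & lo <= c <= hi.
Proof.
move=> avg win; have le_lohi : lo <= hi by have := win 0%N isT; lra.
have bnd j : lo <= x (n + j)%N <= hi.
  split; last by apply: (averaging_bound avg) => i /win [].
  suff: - x (n + j)%N <= - lo by lra.
  by apply: (averaging_bound (averaging_opp avg)) => i /win; lra.
have [_ w_gt0 _ _] := avg; have w_le1 := averaging_last_le1 avg.
set k := 1 - w N ^ N / 2.
have k_bnd : 0 <= k < 1.
  have := pow_lt _ N w_gt0; have := pow_incr (w N) 1 N; rewrite pow1 /k; lra.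
have nest p : exists m lo' hi', [/\ lo' <= hi', hi' - lo' = k ^ p * (hi - lo)
    & forall j, lo' <= x (m + j)%N <= hi'].
  elim: p => [|p [m [lo' [hi' [le' def' bnd']]]]].
    by exists n, lo, hi; split=> //=; lra.
  have [lo2 [hi2 [le2 def2 bnd2]]] := averaging_contract avg le' bnd'.
  by exists (m + N)%N, lo2, hi2; split=> //; rewrite def2 def' -/k /=; lra.
have cauchy : Cauchy_crit x.
  move=> eps eps_gt0.
  (* The [+ 1] keeps the divisor positive when [hi = lo]. *)
  have d_gt0 : 0 < eps / (hi - lo + 1) by apply: Rdiv_lt_0_compat; lra.
  have [|p small] := pow_lt_1_zero k _ _ d_gt0; first by rewrite Rabs_pos_eq; lra.
  have [m [lo' [hi' [le' def' bnd']]]] := nest p.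
  have lt_eps : hi' - lo' < eps.
    have := small p (le_n p); rewrite Rabs_pos_eq; last by apply: pow_le; lra.
    move=> /(Rmult_lt_compat_r (hi - lo + 1)).
    rewrite /Rdiv Rmult_assoc Rinv_l; last by lra.
    by have := pow_le k p; rewrite def'; lra.
  exists m => i j ge_i ge_j; rewrite /Rdist.
  have := bnd' (i - m)%N; have := bnd' (j - m)%N.
  rewrite !subnKC; try lia.
  by move=> bi bj; apply: Rabs_def1; lra.
have [c x_cv] := R_complete x cauchy; exists c => //.
split; apply: Rnot_lt_le => lt_c.
  have [|m near] := x_cv (lo - c); first by lra.
  have := near (n + m)%N; have := bnd m; rewrite /Rdist => bm /(_ ltac:(lia)).
  by move=> /Rabs_def2; lra.
have [|m near] := x_cv (c - hi); first by lra.
have := near (n + m)%N; have := bnd m; rewrite /Rdist => bm /(_ ltac:(lia)).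
by move=> /Rabs_def2; lra.
Qed.

(** Dividing by [r ^ n] rescales the weights, and the equation satisfied by [r] says exactly that
    the new ones sum to 1. *)
Lemma averaging_normalize (N : nat) (w b : nat -> R) (r : R) :
  0 < r -> (forall j, 0 <= w j) -> 0 < w N ->
  sum_f_R0 (fun j => w j * r ^ j) N = r ^ N.+1 ->
  (forall n, b (n + N.+1)%N = sum_f_R0 (fun j => w j * b (n + j)%N) N) ->
  averaging N (fun j => w j * r ^ j / r ^ N.+1) (fun n => b n / r ^ n).
Proof.
move=> r_gt0 w_ge0 w_gt0 root b_rec; have pow_gt0 k := pow_lt r k r_gt0.
have sum_div (f : nat -> R) (c : R) : sum_f_R0 (fun j => f j / c) N = sum_f_R0 f N / c.
  by rewrite /Rdiv Rmult_comm scal_sum.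
split.
- move=> j _; apply: Rmult_le_pos; last by apply: Rlt_le; apply: Rinv_0_lt_compat.
  by apply: Rmult_le_pos; last exact: Rlt_le.
- by apply: Rdiv_lt_0_compat (pow_gt0 _); apply: Rmult_lt_0_compat.
- by rewrite sum_div root; apply: Rinv_r; have := pow_gt0 N.+1; lra.
move=> n; rewrite b_rec -sum_div; apply: PartSum.sum_eq => j _.
rewrite !pow_add; have := pow_gt0 n; have := pow_gt0 j; have := pow_gt0 N.+1.
by move: (r ^ N.+1) (r ^ n) (r ^ j) => u v t *; field; lra.
Qed.

Lemma cv_ratio (b : nat -> R) (r c : R) :
  0 < r -> 0 < c -> Un_cv (fun n => b n / r ^ n) c ->
  Un_cv (fun n => b n.+1 / b n) r /\ Un_cv (fun n => b n / (c * r ^ n)) 1.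
Proof.
move=> r_gt0 c_gt0 b_cv.
have cst_cv (l : R) : Un_cv (fun _ => l) l.
  by move=> e e_gt0; exists 0%N => n _; rewrite Rdist_eq.
split.
  have inv_cv : Un_cv (fun n => / (b n / r ^ n)) (/ c).
    apply: (continuity_seq Rinv (fun n => b n / r ^ n)) b_cv.
    apply: (continuity_pt_inv id); last by rewrite /id; lra.
    exact: derivable_continuous_pt (derivable_pt_id _).
  (* The ratio is the shifted normalized sequence, times the inverse of the unshifted one, times
     [r]. *)
  have := CV_mult _ _ _ _ (CV_mult _ _ _ _ (CV_shift' _ 1%N _ b_cv) inv_cv)
            (cst_cv r).
  rewrite (_ : c * / c * r = r); last by field; lra.
  apply: Un_cv_ext => n; rewrite /Rdiv Rinv_mult Rinv_inv Nat.add_1_r /=.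
  have := pow_lt r n r_gt0; move: (/ b n) (r ^ n) => t u u_gt0; field; lra.
have := CV_mult _ _ _ _ b_cv (cst_cv (/ c)).
rewrite (_ : c * / c = 1); last by field; lra.
apply: Un_cv_ext => n; rewrite /Rdiv Rinv_mult; ring.
Qed.

(** * Integer certificates for polynomial signs and real powers *)

Fixpoint eval_coefs (c : seq Z) (y : R) : R :=
  if c is x :: c' then IZR x + y * eval_coefs c' y else 0.

(* [d ^ size c] and the value of [c] at [z / d] multiplied by it. *)
Fixpoint eval_frac (z d : Z) (c : seq Z) : Z * Z :=
  if c is x :: c' then
    let ph := eval_frac z d c' in
    (Z.mul d ph.1, Z.add (Z.mul x (Z.mul d ph.1)) (Z.mul z ph.2))
  else (Z.one, Z.zero).

(** Reduces the sign of a polynomial at a rational point to that of a computable integer. *)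
Lemma eval_fracP (z d : Z) (c : seq Z) :
  0 < IZR d ->
  0 < IZR (eval_frac z d c).1 /\
  eval_coefs c (IZR z / IZR d) * IZR (eval_frac z d c).1 = IZR (eval_frac z d c).2.
Proof.
move=> d_gt0; elim: c => [|x c] /=; first by rewrite /Z.one /Z.zero; lra.
case: (eval_frac z d c) => p h /= [p_gt0 def_h]; rewrite plus_IZR !mult_IZR -def_h.
by split; [exact: Rmult_lt_0_compat | field; lra].
Qed.

(* Integer enclosure of [d * r ^ n] for [zl / d <= r <= zh / d]; it keeps the numbers much
   smaller than the exact powers of [zl] and [zh]. *)
Definition pow_lo (zl d l : Z) : Z := Z.div (Z.mul l zl) d.
Definition pow_hi (zh d u : Z) : Z := Z.succ (Z.div (Z.mul u zh) d).

(** Each step multiplies by an end of the interval for [r] and rounds outwards, so the enclosure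
    persists. *)
Lemma pow_enclosure (zl zh d : Z) (r : R) (n : nat) :
  Z.lt 0 d -> Z.le 0 zl -> IZR zl / IZR d <= r <= IZR zh / IZR d ->
  IZR (iter n (pow_lo zl d) d) <= r ^ n * IZR d <= IZR (iter n (pow_hi zh d) d).
Proof.
move=> d_gt0 /IZR_le zl_ge0 [ge_r le_r]; have /IZR_lt d_gt0R := d_gt0.
have ge_rd : IZR zl <= r * IZR d.
  have := Rmult_le_compat_r _ _ _ (Rlt_le _ _ d_gt0R) ge_r.
  by rewrite /Rdiv Rmult_assoc Rinv_l; lra.
have le_rd : r * IZR d <= IZR zh.
  have := Rmult_le_compat_r _ _ _ (Rlt_le _ _ d_gt0R) le_r.
  by rewrite /Rdiv Rmult_assoc Rinv_l; lra.
have r_ge0 : 0 <= r by apply: Rle_trans ge_r; apply: Rle_mult_inv_pos.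
elim: n => [|n [lo_n hi_n]]; first by rewrite /=; lra.
rewrite !iterS; set l := iter n _ d in lo_n *; set u := iter n _ d in hi_n *.
have rn_ge0 := pow_le r n r_ge0.
have /IZR_le := Z.mul_div_le (Z.mul l zl) d d_gt0.
have /IZR_lt := Z.mul_succ_div_gt (Z.mul u zh) d d_gt0.
rewrite -/(pow_lo zl d l) -/(pow_hi zh d u) !mult_IZR => hi_u lo_l.
have zl_l : IZR l * IZR zl <= r ^ n * IZR d * (r * IZR d).
  apply: Rle_trans (Rmult_le_compat_r _ _ _ zl_ge0 lo_n) _.
  by apply: Rmult_le_compat_l ge_rd; apply: Rmult_le_pos; lra.
have zh_u : r ^ n * IZR d * (r * IZR d) <= IZR u * IZR zh.
  apply: Rmult_le_compat => //; apply: Rmult_le_pos; lra.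
by split; apply: (Rmult_le_reg_r _ _ _ d_gt0R) => /=; lra.
Qed.

Local Close Scope R_scope.

(* Imported only here: it shadows the real-number tactics [ring] and [field] used above. *)
From mathcomp Require Import ring.

(** * Counting by a finite automaton *)

Lemma includes_cons (x : nat) (w b : seq nat) :
  includes (x :: w) b =
  ((size b <= (size w).+1) &&
   all (fun j => nth 0 b j <= nth 0 (x :: w) j) (iota 0 (size b)))
  || includes w b.
Proof.
rewrite /includes [size (x :: w)]/=.
case: (leqP (size b) (size w)) => [le_bw | lt_wb].
  rewrite (leqW le_bw) !andTb subSn //.
  by rewrite -[iota 0 _.+2]/(0 :: iota (1 + 0) _.+1) (iotaDl 1 0) /= has_map.
have [-> | ne_b] := eqVneq (size b) (size w).+1; last first.
  by rewrite leqNgt ltn_neqAle eq_sym ne_b lt_wb.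
by rewrite leqnn subnn /= !orbF.
Qed.

(** The strict bounds are one below the parts of 252, 343 and 424. *)
Definition bad (x y z : nat) : bool :=
  [|| [&& 1 < x, 4 < y & 1 < z], [&& 2 < x, 3 < y & 2 < z]
    | [&& 3 < x, 1 < y & 3 < z]].

Fixpoint good_after (x y : nat) (w : seq nat) : bool :=
  if w is z :: w' then ~~ bad x y z && good_after y z w' else true.

Lemma avoids_all_cons2 (x y : nat) (w : seq nat) :
  avoids_all (x :: y :: w) = good_after x y w.
Proof.
elim: w x y => [|z w IHw] x y; first by rewrite /avoids_all /avoids /includes.
rewrite /= -IHw /avoids_all /avoids !(includes_cons x) /= /bad !andbT.
by do 9![case: (_ < _) => //=]; do ?[case: (includes _ _) => //=].
Qed.

(** Two fictitious parts 0 may precede [w]: all pattern parts are at least 2, so a triple containing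
    0 is never [bad]. *)
Lemma avoids_allE (w : seq nat) : avoids_all w = good_after 0 0 w.
Proof.
by case: w => [|x [|y w]] //; rewrite avoids_all_cons2.
Qed.

(* [SA] ... [SF]: the possible futures after the last two parts [x], [y]
   (see [state_of]); [SD] merges [x <= 2, y = 4] with [x = 1, y >= 5]. *)
Inductive state := SA | SB | SC | SD | SD' | SE' | SF.

Definition state_of (x y : nat) : state :=
  match y with
  | 0 | 1 => SA
  | 2 => if x <= 3 then SB else SF
  | 3 => if x <= 3 then SC else SF
  | 4 => if x <= 2 then SD else SD'
  | _ => if x <= 1 then SD else SE'
  end.

Definition delta (s : state) (z : nat) : option state :=
  match z, s with
  | (0 | 1), _ => Some SA
  | 2, (SA | SB | SC | SF) => Some SB
  | 2, (SD | SD') => Some SF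
  | 3, (SA | SB | SC | SF) => Some SC
  | 3, SD => Some SF
  | 4, (SA | SB) => Some SD
  | 4, (SC | SD) => Some SD'
  | _.+4, SA => Some SD
  | _.+4, (SB | SC | SD) => Some SE'
  | _, _ => None
  end.

Fixpoint accepts (s : state) (w : seq nat) : bool :=
  if w is z :: w' then
    if delta s z is Some s' then accepts s' w' else false
  else true.

Lemma delta_state_of (x y z : nat) :
  delta (state_of x y) z = if bad x y z then None else Some (state_of y z).
Proof.
(* No test distinguishes values of [x] from 4 on, or of [y] and [z] from 5 on, so finitely many
   cases remain. *)
by move: x y z => [|[|[|[|x]]]] [|[|[|[|[|y]]]]] [|[|[|[|[|z]]]]].
Qed.

Lemma acceptsE (x y : nat) (w : seq nat) :
  accepts (state_of x y) w = good_after x y w.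
Proof.
elim: w x y => //= z w IHw x y.
by rewrite delta_state_of; case: (bad x y z).
Qed.

(** The bound [m] on the parts is independent of [n], so that removing the first part lowers [n]
    without changing the type of the parts. *)
Definition cnt (m k : nat) (s : state) (n : nat) : nat :=
  #|[set t : k.-tuple 'I_m | is_composition n (map val t) && accepts s (map val t)]|.

Definition after (f : state -> nat -> nat) (s : state) (z n : nat) : nat :=
  if delta s z is Some s' then f s' n else 0.

Lemma cnt0 (m : nat) (s : state) (n : nat) : cnt m 0 s n = (n == 0).
Proof.
rewrite /cnt (_ : [set t | _] = if n == 0 then setT else set0).
  by case: eqP; rewrite ?cardsT ?card_tuple ?cards0.
apply/setP => t; rewrite inE tuple0 /is_composition /= andbT eq_sym.
by case: eqP; rewrite inE.
Qed.

Lemma cntS (m k : nat) (s : state) (n : nat) :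
  cnt m k.+1 s n = \sum_(z < m | 0 < z <= n) after (cnt m k) s z (n - z).
Proof.
rewrite /cnt -sum1_card.
rewrite (reindex (fun p : 'I_m * k.-tuple 'I_m => [tuple of p.1 :: p.2])) /=; last first.
  exists (fun t : k.+1.-tuple 'I_m => (thead t, [tuple of behead t])) => [[z t] _|t _] /=.
    by congr (_, _); apply: val_inj.
  by rewrite [RHS]tuple_eta; apply: val_inj.
under eq_bigl => p do rewrite inE.
rewrite -(pair_big_dep xpredT (fun (z : 'I_m) (t : k.-tuple 'I_m) =>
   is_composition n (map val (z :: t)) && accepts s (map val (z :: t))) (fun _ _ => 1)) /=.
rewrite [RHS]big_mkcond; apply: eq_bigr => z _; rewrite /after /is_composition /=.
case: (posnP z) => [_|z_gt0] /=; first by rewrite big_pred0.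
case: leqP => [le_zn|lt_nz]; last first.
  rewrite big_pred0 // => t; case: eqP; rewrite ?andbF // => def_n.
  by move: lt_nz; rewrite -def_n ltnNge leq_addr.
case: (delta s z) => [s'|]; last by rewrite big_pred0 // => t; rewrite andbF.
rewrite -sum1_card; apply: eq_bigl => t; rewrite inE /is_composition.
by rewrite -[in LHS](subnKC le_zn) eqn_add2l.
Qed.

Definition tot (m K : nat) (s : state) (n : nat) : nat := \sum_(k < K) cnt m k s n.

Lemma totS (m K : nat) (s : state) (n : nat) :
  tot m K.+1 s n =
  (n == 0) + \sum_(z < m | 0 < z <= n) after (tot m K) s z (n - z).
Proof.
rewrite /tot big_ord_recl cnt0; congr (_ + _).
under eq_bigr => k _ do rewrite lift0 cntS.
rewrite exchange_big; apply: eq_bigr => z _ /=.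
by rewrite /after; case: (delta s z) => [s'|] //; rewrite big1.
Qed.

Definition comps (s : state) (n : nat) : nat := tot n.+1 n.+1 s n.

(** Parts above [n] contribute nothing, and removing a positive first part lowers both [n] and the
    allowed length; induction on [n] then removes both bounds. *)
Lemma tot_comps (m K : nat) (s : state) (n : nat) :
  n < m -> n < K -> tot m K s n = comps s n.
Proof.
have [b] := ubnP n; elim: b => // b IHb in m K s n *; rewrite ltnS => le_nb.
case: m K => [|m] [|K] // lt_nm lt_nK; rewrite /comps !totS; congr (_ + _).
rewrite -!(big_mkord (fun z => 0 < z <= n) (fun z => after _ s z (n - z))).
rewrite [LHS](big_cat_nat (n := n.+1)) //= addnC big_nat_cond big_pred0 ?add0n; last first.
  by move=> z; case: (ltnP n z); rewrite ?andbF.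
rewrite big_nat_cond [RHS]big_nat_cond; apply: eq_bigr => z /and3P[_ z_gt0 le_zn].
rewrite /after; case: (delta s z) => // s'.
have lt_nz : n - z < n by rewrite ltn_subrL z_gt0 (leq_trans z_gt0).
have lt_nzb := leq_trans lt_nz le_nb.
by rewrite !IHb // (leq_trans lt_nz) // -ltnS // ltnW.
Qed.

Lemma compsE (s : state) (n : nat) :
  comps s n = (n == 0) + \sum_(1 <= z < n.+1) after comps s z (n - z).
Proof.
rewrite {1}/comps totS; congr (_ + _).
rewrite -(big_mkord (fun z => 0 < z <= n) (fun z => after _ s z (n - z))).
rewrite big_ltn_cond //= big_nat_cond [RHS]big_nat_cond.
apply: eq_big => [z | z /and3P[/andP[z_gt0 le_zn] _ _]].
  by rewrite ltnS; case: (0 < z <= n).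
rewrite /after; case: (delta s z) => // s'.
have lt_nz : n - z < n by rewrite ltn_subrL z_gt0 (leq_trans z_gt0).
by rewrite tot_comps // ltnW.
Qed.

Lemma aE (n : nat) : a n = comps SA n.
Proof.
apply: eq_bigr => k _; apply: eq_card => t.
by rewrite !inE avoids_allE -acceptsE.
Qed.

(** * The generating function *)

Local Open Scope ring_scope.

(** Congruence to 0 modulo ['X^N]: truncated polynomials stand in for power series. *)
Definition zero_below (N : nat) (p : {poly int}) : Prop := forall n, (n < N)%N -> p`_n = 0.

Lemma zero_belowD (N : nat) (p q : {poly int}) :
  zero_below N p -> zero_below N q -> zero_below N (p + q).
Proof. by move=> p0 q0 n lt_nN; rewrite coefD p0 ?q0 ?addr0. Qed.

Lemma zero_belowN (N : nat) (p : {poly int}) : zero_below N p -> zero_below N (- p).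
Proof. by move=> p0 n lt_nN; rewrite coefN p0 ?oppr0. Qed.

Lemma zero_belowMl (N : nat) (p q : {poly int}) :
  zero_below N q -> zero_below N (p * q).
Proof.
move=> q0 n lt_nN; rewrite coefM big1 // => i _.
by rewrite q0 ?mulr0 // (leq_ltn_trans (leq_subr _ _)).
Qed.

Definition comps_poly (N : nat) (s : state) : {poly int} :=
  \poly_(i < N) (comps s i)%:R.

Definition after_poly (N : nat) (s : state) (z : nat) : {poly int} :=
  if delta s z is Some s' then comps_poly N s' else 0.

Definition geom (N : nat) : {poly int} := \sum_(i < N) 'X^i.

Lemma geom_zero_below (N : nat) : zero_below N ((1 - 'X) * geom N - 1).
Proof.
move=> n lt_nN; rewrite -(opprB 'X) mulNr -subrX1 opprB addrAC subrr add0r coefN coefXn.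
by rewrite (ltn_eqF lt_nN) oppr0.
Qed.

(** This is [compsE] summed over [n]. All parts from 5 on have the same transition, so they share
    one term, with [geom N] as the truncated [1 / (1 - x)]. *)
Lemma comps_poly_zero_below (N : nat) (s : state) :
  zero_below N (comps_poly N s - (1 + 'X * after_poly N s 1 + 'X^2 * after_poly N s 2
    + 'X^3 * after_poly N s 3 + 'X^4 * after_poly N s 4
    + 'X^5 * geom N * after_poly N s 5)).
Proof.
have ->: 1 + 'X * after_poly N s 1 + 'X^2 * after_poly N s 2
    + 'X^3 * after_poly N s 3 + 'X^4 * after_poly N s 4
    + 'X^5 * geom N * after_poly N s 5
  = 1 + \sum_(1 <= z < 5 + N) 'X^z * after_poly N s z.
  rewrite (big_cat_nat (n := 5)) ?leq_addr //=.
  rewrite (big_addn 0 (5 + N) 5) addKn big_mkord /geom mulr_sumr mulr_suml.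
  rewrite -[LHS]addrA -!addrA; congr (1 + _).
  do 4!rewrite big_ltn //.
  rewrite big_geq // expr1 addr0 -!addrA; do !congr (_ + _).
  by apply: eq_bigr => i _; rewrite (addnC i) exprD.
move=> n lt_nN; rewrite coefB coefD coef_sum coef_poly lt_nN compsE natrD natr_sum coef1.
apply/eqP; rewrite subr_eq0; apply/eqP; congr (_ + _).
(* Parts larger than [n] do not reach the coefficient of degree [n]. *)
rewrite [RHS](big_cat_nat (n := n.+1)) ?(leq_trans lt_nN (leq_addl _ _)) //=.
rewrite [X in _ = _ + X]big_nat_cond [X in _ = _ + X]big1 ?addr0; last first.
  by move=> z /andP[/andP[lt_nz _] _]; rewrite coefXnM lt_nz.
apply: eq_big_nat => z /andP[_ le_zn]; rewrite coefXnM ltnNge -ltnS le_zn /=.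
rewrite /after /after_poly; case: (delta s z) => [s'|]; last by rewrite coef0.
by rewrite coef_poly (leq_ltn_trans (leq_subr _ _) lt_nN).
Qed.

(* Gaussian elimination; [h..] are the equations of the system, with [g = 1 / (1 - x)]. *)
Lemma gf_elimination (R : comNzRingType) (x g A B C D D' E F : R) :
  let hA := A - (1 + x * A + x ^+ 2 * B + x ^+ 3 * C + x ^+ 4 * D + x ^+ 5 * g * D) in
  let hB := B - (1 + x * A + x ^+ 2 * B + x ^+ 3 * C + x ^+ 4 * D + x ^+ 5 * g * E) in
  let hC := C - (1 + x * A + x ^+ 2 * B + x ^+ 3 * C + x ^+ 4 * D' + x ^+ 5 * g * E) in
  let hD := D - (1 + x * A + x ^+ 2 * F + x ^+ 3 * F + x ^+ 4 * D' + x ^+ 5 * g * E) in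
  let hD' := D' - (1 + x * A + x ^+ 2 * F) in
  let hE := E - (1 + x * A) in
  let hF := F - (1 + x * A + x ^+ 2 * B + x ^+ 3 * C) in
  let hg := (1 - x) * g - 1 in
  let d := 1 - x in
  let alpha := 1 - x ^+ 2 - x ^+ 3 - x ^+ 8 - 2 * x ^+ 9 - x ^+ 12 in
  let gamma := x ^+ 2 + x ^+ 3 + x ^+ 6 in
  let kC := d * (hC - hF) + x ^+ 5 * E * hg + d * x ^+ 4 * hD' + x ^+ 5 * hE in
  let kD := d * (hD - hD') + x ^+ 5 * E * hg + d * (1 + x ^+ 4) * hD' + x ^+ 5 * hE in
  let kB := d * (hB - hF) + x ^+ 5 * E * hg + x ^+ 4 * kD + x ^+ 5 * hE in
  let kF := d * hF + x ^+ 2 * kB + x ^+ 3 * kC in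
  let kA := d * (d * (hA - hF) + x ^+ 5 * D * hg) + x ^+ 4 * kD in
  - (alpha * kA + (d + x ^+ 4 * gamma) * kF) =
  (-1 + 3 * x - 2 * x ^+ 2 - x ^+ 4 + 2 * x ^+ 5 - x ^+ 6 + x ^+ 7 + x ^+ 8 - 3 * x ^+ 10
   + 3 * x ^+ 11 - 2 * x ^+ 12 - 2 * x ^+ 13 + 2 * x ^+ 14 + 3 * x ^+ 15 + x ^+ 18) * A
  + (1 - 2 * x + x ^+ 2 + x ^+ 4 - x ^+ 5 + x ^+ 6 + x ^+ 10 - 3 * x ^+ 11 + x ^+ 13
   + 3 * x ^+ 14 + x ^+ 17).
Proof.
move=> hA hB hC hD hD' hE hF hg d alpha gamma kC kD kB kF kA; pose e := 1 + x * A.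
(* Modulo the equations, [E = e] and [D' = e + x ^+ 2 * F]; the [k..] then successively express the
   other unknowns through [F] and [e]. *)
have kCE : kC = d * C - (d * F + d * x ^+ 4 * (e + x ^+ 2 * F) + x ^+ 5 * e).
  by rewrite /kC /hC /hF /hg /hD' /hE /e /d; ring.
have kDE : kD = d * D - (d * (1 + x ^+ 4) * (e + x ^+ 2 * F) + d * x ^+ 3 * F + x ^+ 5 * e).
  by rewrite /kD /hD /hg /hD' /hE /e /d; ring.
have kBE : kB = d * B - (d * F + x ^+ 4 * (d * D - kD) + x ^+ 5 * e).
  by rewrite /kB /hB /hF /hg /hE /e /d; ring.
have kFE : kF = d * F - (d * e + x ^+ 2 * (d * B - kB) + x ^+ 3 * (d * C - kC)).
  by rewrite /kF /hF /e; ring.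
have kAE : kA = d ^+ 2 * A - (d ^+ 2 * F + x ^+ 4 * (d * D - kD)).
  by rewrite /kA /hA /hF /hg /d; ring.
(* After substitution [F] has coefficient [d * alpha] in [kF] and [- d * (d + x ^+ 4 * gamma)] in
   [kA], so the combination cancels [F]. *)
rewrite kAE kFE kBE kCE kDE /alpha /gamma /e /d; ring.
Qed.

Lemma gf_recurrence (n : nat) :
  \sum_(i < n.+1) nth 0 Qden i * (a (n - i))%:Z = - nth 0 Pnum n.
Proof.
pose N := n.+1; pose p s := comps_poly N s.
suffices: (Poly Qden * p SA + Poly Pnum)`_n = 0.
  rewrite coefD coefM coef_Poly => /eqP; rewrite addr_eq0 => /eqP <-.
  apply: eq_bigr => i _; rewrite coef_Poly coef_poly ltnS leq_subr aE.
  by rewrite -natz.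
have polyE (c : int) (q : {poly int}) : cons_poly c q = q * 'X + c%:~R.
  by rewrite cons_poly_def -[c in LHS]intz rmorph_int.
have -> : Poly Qden * p SA + Poly Pnum =
  (-1 + 3 * 'X - 2 * 'X ^+ 2 - 'X ^+ 4 + 2 * 'X ^+ 5 - 'X ^+ 6 + 'X ^+ 7 + 'X ^+ 8
   - 3 * 'X ^+ 10 + 3 * 'X ^+ 11 - 2 * 'X ^+ 12 - 2 * 'X ^+ 13 + 2 * 'X ^+ 14
   + 3 * 'X ^+ 15 + 'X ^+ 18) * p SA
  + (1 - 2 * 'X + 'X ^+ 2 + 'X ^+ 4 - 'X ^+ 5 + 'X ^+ 6 + 'X ^+ 10 - 3 * 'X ^+ 11
   + 'X ^+ 13 + 3 * 'X ^+ 14 + 'X ^+ 17).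
  by rewrite /Qden /Pnum /= !polyE; ring.
rewrite -(gf_elimination 'X (geom N) (p SA) (p SB) (p SC) (p SD) (p SD') (p SE') (p SF)).
have zg := @geom_zero_below N; have := @comps_poly_zero_below N.
move=> zs; have [zA zB zC zD] := And4 (zs SA) (zs SB) (zs SC) (zs SD).
have [zD' zE' zF] := And3 (zs SD') (zs SE') (zs SF); clear zs.
rewrite /after_poly /= !mulr0 !addr0 in zA zB zC zD zD' zE' zF.
(* The polynomial is now a combination of expressions vanishing below degree [N = n.+1], hence so
   does its coefficient [n]. *)
apply: (_ : zero_below N _); last exact: leqnn.
by repeat first [assumption | apply: zero_belowN | apply: zero_belowD | apply: zero_belowMl].
Qed.

(** * Computed terms and linear recurrences *)

Fixpoint dot (q l : seq Z) : Z :=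
  if q is c :: q' then if l is x :: l' then c * x + dot q' l' else 0 else 0.

Lemma dotE (q l : seq Z) : dot q l = \sum_(i < size l) q`_i * l`_i.
Proof.
elim: q l => [|c q IHq] [|x l] /=; rewrite ?big_ord0 //.
  by rewrite big1 // => i _; rewrite nth_nil mul0r.
by rewrite big_ord_recl IHq.
Qed.

(** Latest term first, so that the convolution with the denominator is a dot product; the constant
    coefficient -1 of [Qden] lets the recurrence be solved for the new term. *)
Fixpoint a_rev (n : nat) : seq Z :=
  if n is n'.+1 then
    let l := a_rev n' in (Z_of_int Pnum`_n' + dot (map Z_of_int (behead Qden)) l) :: l
  else [::].

Lemma a_revE (n : nat) : a_rev n = rev [seq Z.of_nat (a i) | i <- iota 0 n].
Proof.
elim: n => // n IHn; rewrite [a_rev n.+1]lock -addn1 iotaD map_cat rev_cat -IHn -lock addn1.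
rewrite -[LHS]/(Z_of_int Pnum`_n + dot (map Z_of_int (behead Qden)) (a_rev n) :: a_rev n).
rewrite -[RHS]/(Z_of_int (a n)%:Z :: a_rev n); congr (_ :: _).
rewrite dotE IHn size_rev size_map size_iota.
have := gf_recurrence n; rewrite big_ord_recl subn0 => /eqP; rewrite -addr_eq0 mulN1r -addrA addrC.
rewrite subr_eq0 => /eqP <-; rewrite rmorphD addrC rmorph_sum; congr (_ + _).
apply: eq_bigr => i _; rewrite rmorphM lift0; congr (_ * _).
  rewrite -nth_behead; have [lt_i | le_i] := ltnP i (size (behead Qden)).
    by rewrite (nth_map 0).
  by rewrite !nth_default ?size_map.
have lt_ni : (n - i.+1 < n)%N by rewrite ltn_subrL (leq_ltn_trans _ (ltn_ord i)).
by rewrite nth_rev ?size_map ?size_iota // (nth_map 0%N) ?size_iota // nth_iota.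
Qed.

Lemma first_terms : [seq Z.of_nat (a n) | n <- iota 0 31] = a_first_terms.
Proof.
have e : rev (a_rev 31) = a_first_terms by vm_compute.
by rewrite -e (a_revE 31) revK.
Qed.

(** The numerator has degree 17, so the recurrence is homogeneous from index 18 on. *)
Lemma a_rec18 (t : nat) :
  (a (t + 18))%:Z = 3 * (a (t + 17))%:Z - 2 * (a (t + 16))%:Z - (a (t + 14))%:Z
    + 2 * (a (t + 13))%:Z - (a (t + 12))%:Z + (a (t + 11))%:Z + (a (t + 10))%:Z
    - 3 * (a (t + 8))%:Z + 3 * (a (t + 7))%:Z - 2 * (a (t + 6))%:Z - 2 * (a (t + 5))%:Z
    + 2 * (a (t + 4))%:Z + 3 * (a (t + 3))%:Z + (a (t + 0))%:Z.
Proof.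
have := gf_recurrence (t + 18).
rewrite -(big_mkord xpredT (fun i => nth 0 Qden i * (a (t + 18 - i))%:Z)).
rewrite (big_cat_nat (n := 19)) ?ltnS ?leq_addl //= [X in _ + X]big_nat_cond.
rewrite [X in _ + X]big1 ?addr0; last first.
  by move=> i /andP[/andP[le_i _] _]; rewrite nth_default ?mul0r.
rewrite [nth 0 Pnum _]nth_default ?leq_addl // unlock /=.
rewrite -!addnBA // !subSS !subn0; lia.
Qed.

Definition weights : seq nat :=
  [:: 5; 9; 10; 25; 45; 45; 28; 26; 12; 1; 3; 1; 1; 9; 10; 4; 0; 4; 7; 6; 8; 0; 1; 1;
      2; 0; 1; 1]%N.

(* Amounts to multiplying the denominator by
   [1+2x+3x^2+5x^3+6x^4+7x^5+8x^6+10x^7+10x^8+9x^9+5x^10], found by computer search. *)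
Lemma a_rec28 (n : nat) :
  a (n + 28) = (\sum_(j < 28) nth 0 weights j * a (n + j))%N.
Proof.
apply/eqP; rewrite -eqz_nat; apply/eqP.
rewrite [RHS](big_morph Posz PoszD (erefl _)) [RHS](eq_bigr _ (fun j _ => PoszM _ _)).
pose u j := (a (n + j))%:Z; rewrite -/(u 28%N).
rewrite -(big_mkord xpredT (fun j => (nth 0 weights j)%:Z * u j)) unlock /=.
have r k : u (k + 18)%N = 3 * u (k + 17)%N - 2 * u (k + 16)%N - u (k + 14)%N
    + 2 * u (k + 13)%N - u (k + 12)%N + u (k + 11)%N + u (k + 10)%N - 3 * u (k + 8)%N
    + 3 * u (k + 7)%N - 2 * u (k + 6)%N - 2 * u (k + 5)%N + 2 * u (k + 4)%N
    + 3 * u (k + 3)%N + u (k + 0)%N.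
  by rewrite /u !addnA a_rec18.
clearbody u.
move: (r 0) (r 1%N) (r 2%N) (r 3%N) (r 4%N) (r 5%N) (r 6%N) (r 7%N) (r 8%N) (r 9%N) (r 10%N).
cbv [addn Nat.add] => {r} r0 r1 r2 r3 r4 r5 r6 r7 r8 r9 r10.
(* Highest index first: each substitution brings in only lower terms, which the later ones
   expand. *)
rewrite r10 r9 r8 r7 r6 r5 r4 r3 r2 r1 r0; ring.
Qed.

Local Close Scope ring_scope.

(** * The growth rate *)

Local Open Scope R_scope.

Definition weight (j : nat) : R := INR (nth 0%N weights j).

Definition recurrence_poly (y : R) : R :=
  y ^ 28 - sum_f_R0 (fun j => weight j * y ^ j) 27.

Lemma recurrence_poly_continuous : continuity recurrence_poly.
Proof.
apply: (continuity_minus (fun y => y ^ 28)); last exact: continuity_finite_sum.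
by apply: derivable_continuous; apply: derivable_pow.
Qed.

Definition recurrence_coefs : seq Z :=
  rcons [seq Z.opp (Z.of_nat k) | k <- weights] (Zpos xH).

Lemma recurrence_polyE (y : R) : recurrence_poly y = eval_coefs recurrence_coefs y.
Proof. by rewrite /recurrence_poly /weight /=; lra. Qed.

(* [2 ^ 56], and the two consecutive multiples of [2 ^ -56] enclosing the root. *)
Definition scale : Z := 72057594037927936.
Definition zlo : Z := 142539414408517799.
Definition zhi : Z := 142539414408517800.
Definition rlo : R := IZR zlo / IZR scale.
Definition rhi : R := IZR zhi / IZR scale.

Lemma scale_gt0 : 0 < IZR scale. Proof. by rewrite /scale; lra. Qed.

Lemma recurrence_poly_rlo : recurrence_poly rlo < 0.
Proof.
rewrite recurrence_polyE; have := eval_fracP zlo recurrence_coefs scale_gt0.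
have : Z.ltb (eval_frac zlo scale recurrence_coefs).2 0 by vm_compute.
move: (eval_frac _ _ _) (eval_coefs _ _) => [p h] y /Z.ltb_lt/IZR_lt h_lt0 [p_gt0 def_h].
by apply: (Rmult_lt_reg_r (IZR p)); rewrite // def_h Rmult_0_l.
Qed.

Lemma recurrence_poly_rhi : 0 < recurrence_poly rhi.
Proof.
rewrite recurrence_polyE; have := eval_fracP zhi recurrence_coefs scale_gt0.
have : Z.ltb 0 (eval_frac zhi scale recurrence_coefs).2 by vm_compute.
move: (eval_frac _ _ _) (eval_coefs _ _) => [p h] y /Z.ltb_lt/IZR_lt h_gt0 [p_gt0 def_h].
by apply: (Rmult_lt_reg_r (IZR p)); rewrite // def_h Rmult_0_l.
Qed.

Lemma INR_a_rec28 (n : nat) :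
  INR (a (n + 28)) = sum_f_R0 (fun j => weight j * INR (a (n + j))) 27.
Proof.
rewrite a_rec28; move: 27%N => N; elim: N => [|N IHN].
  by rewrite big_ord_recr big_ord0 /= add0n mult_INR.
by rewrite big_ord_recr /= plus_INR mult_INR IHN.
Qed.

(** Certifies [0.548052912690 <= x / r ^ n <= 0.548052912699] with denominators cleared, where [l]
    and [u] enclose [scale * r ^ n]. The upper end is below 0.54805291270, as the strict bound on
    [c] requires. *)
Fixpoint window_ok (s : seq Z) (l u : Z) : bool :=
  if s is x :: s' then
    [&& Z.leb (548052912690 * u) (x * 1000000000000 * scale),
        Z.leb (x * 1000000000000 * scale) (548052912699 * l)
      & window_ok s' (pow_lo zlo scale l) (pow_hi zhi scale u)]
  else true.

Lemma window_ok_nth (s : seq Z) (l u : Z) (i : nat) :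
  window_ok s l u -> (i < size s)%N ->
  Z.le (548052912690 * iter i (pow_hi zhi scale) u) (nth Z0 s i * 1000000000000 * scale) /\
  Z.le (nth Z0 s i * 1000000000000 * scale) (548052912699 * iter i (pow_lo zlo scale) l).
Proof.
elim: s l u i => // x s IHs l u [|i] /and3P[/Z.leb_le ok_u /Z.leb_le ok_l ok] lt_i //.
by rewrite !iterSr; apply: IHs.
Qed.

Lemma window_okT : window_ok (drop 56 (rev (a_rev 84)))
  (iter 56 (pow_lo zlo scale) scale) (iter 56 (pow_hi zhi scale) scale).
Proof. by vm_compute. Qed.

Lemma window_bounds (r : R) (i : nat) :
  rlo <= r <= rhi -> (i <= 27)%N ->
  548052912690 / 1000000000000 <= INR (a (56 + i)) / r ^ (56 + i)
    <= 548052912699 / 1000000000000.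
Proof.
move=> r_bnd le_i; have := window_ok_nth window_okT (i := i).
rewrite a_revE revK size_drop size_map size_iota => /(_ le_i).
have lt_i : (56 + i < 84)%N by rewrite -[84%N]/(56 + 28)%N ltn_add2l ltnS.
rewrite nth_drop (nth_map 0%N) ?size_iota // nth_iota // -!iterD addnC add0n.
have [] := @pow_enclosure zlo zhi scale r (i + 56); rewrite // addnC.
have := scale_gt0; have : 0 < r ^ (56 + i).
  by apply: pow_lt; move: r_bnd; rewrite /rlo /zlo /scale; lra.
set l := iter _ (pow_lo _ _) _; set u := iter _ (pow_hi _ _) _; set d := scale.
set b := a _; set p := r ^ _; clearbody l u d b p => p_gt0 d_gt0 le_l le_u [].
move=> /IZR_le + /IZR_le; rewrite !mult_IZR -INR_IZR_INZ => lo_b hi_b.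
have up : INR b / p * p = INR b by rewrite /Rdiv Rmult_assoc Rinv_l; lra.
by split; apply: (Rmult_le_reg_r p) => //; rewrite up; apply: (Rmult_le_reg_r (IZR d)) => //; lra.
Qed.

Lemma a_asymptotics : exists r c : R,
  19781317474 / 10000000000 <= r /\ r < 19781317475 / 10000000000 /\
  54805291269 / 100000000000 <= c /\ c < 54805291270 / 100000000000 /\
  Un_cv (fun n => INR (a n.+1) / INR (a n)) r /\
  Un_cv (fun n => INR (a n) / (c * r ^ n)) 1.
Proof.
have lt_rlohi : rlo < rhi by rewrite /rlo /rhi /zlo /zhi /scale; lra.
have [r [r_bnd root]] :=
  IVT _ _ _ recurrence_poly_continuous lt_rlohi recurrence_poly_rlo recurrence_poly_rhi.
have r_gt0 : 0 < r by move: r_bnd; rewrite /rlo /zlo /scale; lra.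
(* The 28 predecessors have indices 0 to 27, and the last entry of [weights] is 1. *)
have avg : averaging 27 (fun j => weight j * r ^ j / r ^ 28) (fun n => INR (a n) / r ^ n).
  apply: averaging_normalize => // [j|||n]; last exact: INR_a_rec28.
  - exact: pos_INR.
  - exact: Rlt_0_1.
  - by move: root; rewrite /recurrence_poly; lra.
have [c c_cv c_bnd] := averaging_cv avg (fun i => @window_bounds r i r_bnd).
have [|ratio_cv asymp_cv] := cv_ratio r_gt0 _ c_cv; first by lra.
exists r, c; rewrite /rlo /rhi /zlo /zhi /scale in r_bnd.
by do 4 (split; first by lra).
Qed.

Local Close Scope R_scope.

Theorem theorem2 :
  (* generating function: (sum_n a(n) x^n) * Q(x) = - P(x) as formal power series *)
  (forall n : nat,
     (\sum_(i < n.+1) nth 0 Qden i * ((a (n - i))%:Z) = - nth 0 Pnum n)%R) /\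
  (* first 31 terms *)
  [seq Z.of_nat (a n) | n <- iota 0 31] = a_first_terms /\
  (* growth rate and asymptotic constant *)
  exists r c : R,
    Rle (Rdiv 19781317474 10000000000) r /\ Rlt r (Rdiv 19781317475 10000000000) /\
    Rle (Rdiv 54805291269 100000000000) c /\ Rlt c (Rdiv 54805291270 100000000000) /\
    Un_cv (fun n => Rdiv (INR (a n.+1)) (INR (a n))) r /\
    Un_cv (fun n => Rdiv (INR (a n)) (Rmult c (pow r n))) (IZR 1).
Proof.
split; first exact: gf_recurrence.
split; [exact: first_terms | exact: a_asymptotics].
Qed.
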